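(* The set $EP$ of exit periods is $EP=\{3,4,5,6\}$.
   Context: Let $T:[0,1]\to[0,1]$ be the doubling map: $Tx=2x$ for $x\in[0,1/2]$ and $Tx=2x-1$ for $x\in(1/2,1]$. An $n$-cycle is a periodic orbit of $T$ of prime (least) period $n$. For $0<a<b<1$, an integer $n\ge 3$ is called bad for $(a,b)$ if every $n$-cycle of $T$ has non-empty intersection with the open interval $(a,b)$. $B(a,b)$ denotes the set of all $n\ge3$ which are bad for $(a,b)$. An integer $n\ge3$ is called an exit period if there exists a continuous family of open intervals $(a_\alpha,b_\alpha)_{\alpha\in[\alpha_0,\alpha_1]}$ (with $\alpha_0<\alpha_1$, $0<a_\alpha<b_\alpha<1$, and endpoints depending continuously on $\alpha$) such that: (i) $(a_\alpha,b_\alpha)\subsetneq(a_{\alpha'},b_{\alpha'})$ whenever $\alpha>\alpha'$; (ii) $B(a_{\alpha_1},b_{\alpha_1})=\varnothing$; (iii) $n$ is bad for $(a_\alpha,b_\alpha)$ for every $\alpha<\alpha_1$. The set of exit periods is denoted $EP$. *)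

(* Defs.v *)
From mathcomp Require Import all_boot all_order all_algebra.
From mathcomp Require Import all_classical all_reals all_analysis.
Import Order.TTheory GRing.Theory Num.Theory.
Import numFieldNormedType.Exports.

Set Implicit Arguments.
Unset Strict Implicit.
Unset Printing Implicit Defensive.

Local Open Scope classical_set_scope.
Local Open Scope ring_scope.

(* The doubling map of [0, 1]. It is extended to all of R by the same formula;
   only its restriction to [0, 1], which it maps into itself, is used. *)
Definition doubling (R : realType) (x : R) : R :=
  if x <= 1 / 2 then 2 * x else 2 * x - 1.

Definition prime_period (X : Type) (f : X -> X) (n : nat) (x : X) : Prop :=
  [/\ (0 < n)%N, iter n f x = x
    & forall k : nat, (0 < k < n)%N -> iter k f x <> x].

Definition is_cycle (R : realType) (n : nat) (C : set R) : Prop :=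
  exists x : R, [/\ 0 <= x <= 1, prime_period (@doubling R) n x
    & C = [set iter k (@doubling R) x | k in [set k : nat | (k < n)%N]]].

Definition bad (R : realType) (a b : R) (n : nat) : Prop :=
  (3 <= n)%N /\
  forall C : set R, is_cycle n C -> C `&` [set` `]a, b[] !=set0.

Definition B (R : realType) (a b : R) : set nat := [set n | bad a b n].

Definition exit_period (R : realType) (n : nat) : Prop :=
  (3 <= n)%N /\
  exists (t0 t1 : R) (a b : R -> R),
    [/\ t0 < t1,
        {within `[t0, t1], continuous a} /\ {within `[t0, t1], continuous b}
      & forall t : R, t0 <= t <= t1 -> [/\ 0 < a t, a t < b t & b t < 1]] /\
    [/\ forall t t' : R, t0 <= t <= t1 -> t0 <= t' <= t1 -> t' < t ->
          [set` `]a t, b t[] `<` [set` `]a t', b t'[],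
        B (a t1) (b t1) = set0
      & forall t : R, t0 <= t < t1 -> bad (a t) (b t) n].

Definition EP (R : realType) : set nat := [set n | exit_period R n].

(* Main.v *)
(** By continuity, n is an exit period iff some closed [p, q] in (0, 1) meets all
    n-cycles while B(p, q) is empty.  The intervals [2/7, 3/7], [3/7, 4/7] (n = 3),
    [6/15, 8/15] (n = 4), [10/31, 16/31] (n = 5), [20/63, 32/63] (n = 6) and their
    reflections in 1/2 meet all n-cycles.  Hence, if none of 3, 4, 5, 6 is bad for
    (a, b) and a + b <= 1, then (a, b) lies in one of the closed intervals [0, 3/7],
    [2/7, 32/63], [20/63, 16/31], [10/31, 8/15], [2/5, 4/7].  For every n >= 7, each
    of these is missed by an n-cycle, whose binary expansion is made of one short
    block followed by copies of 1, of 10 or of 100.  So emptiness of B(a, b) is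
    decided by the periods 3, ..., 6, and a period n >= 7 cannot become good only
    at the end of a family. *)
Require Import Defs.
From mathcomp Require Import all_boot all_order all_algebra.
From mathcomp Require Import all_classical all_reals all_analysis.
From mathcomp Require Import ring lra zify.
Import Order.TTheory GRing.Theory Num.Theory.
Import numFieldNormedType.Exports.

Set Implicit Arguments.
Unset Strict Implicit.
Unset Printing Implicit Defensive.

Local Open Scope classical_set_scope.
Local Open Scope ring_scope.

(** * Cycles contained in a set *)

Definition has_cycle_in (R : realType) (n : nat) (Q : R -> Prop) : Prop :=
  exists2 C : set R, is_cycle n C & forall p, C p -> Q p.

Lemma has_cycle_in_sub (R : realType) (n : nat) (P Q : R -> Prop) :
  (forall p, P p -> Q p) -> has_cycle_in n P -> has_cycle_in n Q.
Proof. by move=> PQ [C cC CP]; exists C => // p /CP /PQ. Qed.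

Lemma not_badE (R : realType) (a b : R) (n : nat) : (3 <= n)%N ->
  ~ bad a b n <-> has_cycle_in n (fun p => ~~ (a < p < b)).
Proof.
move=> n3; split=> [nb|[C cC CQ] [_ /(_ C cC)] [p [/CQ/negP Cp]]]; last first.
  by rewrite /= in_itv.
apply: contrapT => nC; apply: nb; split=> // C cC; apply: contrapT => CI.
apply: nC; exists C => // p Cp; apply/negP => pab; apply: CI.
by exists p; split=> //=; rewrite in_itv.
Qed.

Lemma has_cycle_inP (R : realType) (n : nat) (Q : R -> Prop) (x : R) :
  (0 < n)%N -> 0 <= x <= 1 -> iter n (@doubling R) x = x ->
  (forall k : nat, (0 < k < n)%N -> iter k (@doubling R) x <> x) ->
  (forall k : nat, (k < n)%N -> Q (iter k (@doubling R) x)) ->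
  has_cycle_in n Q.
Proof.
move=> n0 x01 xn xk Qk.
exists [set iter k (@doubling R) x | k in [set k : nat | (k < n)%N]].
  by exists x.
by move=> p [k kn <-]; apply: Qk.
Qed.

(** * Cycles of small period *)

(** Doubling on numerators over [N]; [N] stays [N] instead of becoming 0, since [doubling] fixes
    1. *)
Definition double_mod (N k : nat) : nat :=
  if (k.*2 <= N)%N then k.*2 else (k.*2 - N)%N.

Lemma doubling_frac (R : realType) (N k : nat) : (0 < N)%N ->
  doubling (k%:R / N%:R : R) = (double_mod N k)%:R / N%:R.
Proof.
move=> N0; have N0' : (0 : R) < N%:R by rewrite ltr0n.
have -> : doubling (k%:R / N%:R : R) =
    if (k.*2 <= N)%N then 2 * (k%:R / N%:R) else 2 * (k%:R / N%:R) - 1.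
  rewrite /doubling ler_pdivrMr // -(ler_nat R) -muln2 natrM.
  by congr (if _ then _ else _); apply/idP/idP; lra.
rewrite /double_mod.
case: ifPn => kN; first by rewrite -muln2 natrM mulrA [_ * 2]mulrC.
rewrite natrB -?muln2 ?natrM; last by lia.
by field; rewrite lt0r_neq0.
Qed.

Lemma iter_doubling_frac (R : realType) (N k i : nat) : (0 < N)%N ->
  iter i (@doubling R) (k%:R / N%:R) = (iter i (double_mod N) k)%:R / N%:R.
Proof. by move=> N0; elim: i => //= i ->; rewrite doubling_frac. Qed.

Lemma iter_doubling_mod1 (R : realType) (x : R) (k : nat) :
  exists j : nat, iter k (@doubling R) x + j%:R = 2 ^+ k * x.
Proof.
elim: k => [|k [j IH]]; first by exists 0%N; rewrite addr0 expr0 mul1r.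
rewrite /= /doubling; case: ifP => _.
  by exists (2 * j)%N; rewrite exprS -mulrA -IH natrM; lra.
by exists (2 * j + 1)%N; rewrite exprS -mulrA -IH natrD natrM; lra.
Qed.

(** The n-th iterate sends x to 2^n x - j with [j] an integer, so periodicity gives x = j / (2^n -
    1). *)
Lemma periodic_point_frac (R : realType) (n : nat) (x : R) :
  (0 < n)%N -> 0 <= x <= 1 -> iter n (@doubling R) x = x ->
  exists2 k : nat, (k <= (2 ^ n).-1)%N & x = k%:R / ((2 ^ n).-1)%:R.
Proof.
move=> n0 x01 xn; have [j] := iter_doubling_mod1 x n; rewrite xn => xj.
have n1 : (1 < 2 ^ n)%N by rewrite -[1%N](expn0 2) ltn_exp2l.
have N0 : (0 : R) < ((2 ^ n).-1)%:R by rewrite ltr0n; lia.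
have NE : ((2 ^ n).-1)%:R = 2 ^+ n - 1 :> R.
  by rewrite -subn1 natrB ?natrX //; lia.
have jE : j%:R = x * ((2 ^ n).-1)%:R by rewrite NE; lra.
exists j; last by rewrite jE mulfK // gt_eqF.
by rewrite -(ler_nat R) jE ler_piMl //; case/andP: x01.
Qed.

(* Points of period n are the fractions k / (2 ^ n - 1); the first disjunct discards
   those whose least period is smaller than n. *)
Definition all_cycles_meet (n p q : nat) : bool :=
  all (fun k => has (fun i => iter i (double_mod (2 ^ n).-1) k == k) (iota 1 n.-1)
             || has (fun i => p <= iter i (double_mod (2 ^ n).-1) k <= q)%N
                    (iota 0 n))
      (iota 0 (2 ^ n)).

Lemma all_cycles_meetP (R : realType) (n p q : nat) (C : set R) :
  (0 < n)%N -> all_cycles_meet n p q -> is_cycle n C ->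
  exists2 x, C x & p%:R / ((2 ^ n).-1)%:R <= x <= q%:R / ((2 ^ n).-1)%:R.
Proof.
move=> n0 /allP all_pq [x [x01 [_ xn xk] ->]].
have n1 : (1 < 2 ^ n)%N by rewrite -[1%N](expn0 2) ltn_exp2l.
have N0 : (0 < (2 ^ n).-1)%N by lia.
have [k kN xE] := periodic_point_frac n0 x01 xn.
have /all_pq : k \in iota 0 (2 ^ n) by rewrite mem_iota; lia.
case/orP => /hasP[i]; rewrite mem_iota => i_n /=.
  move=> /eqP ik; case: (xk i); first by lia.
  by rewrite xE iter_doubling_frac // ik.
move=> /andP[pi iq]; exists (iter i (@doubling R) x); first by exists i => //=; lia.
by rewrite xE iter_doubling_frac // !ler_pM2r ?invr_gt0 ?ltr0n // !ler_nat pi.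
Qed.

(* The cycle of k / (2 ^ n - 1) misses the open interval ]l / d, h / d[. *)
Definition cycle_avoids (n k l h d : nat) : bool :=
  let N := (2 ^ n).-1 in
  [&& iter n (double_mod N) k == k,
      all (fun i => iter i (double_mod N) k != k) (iota 1 n.-1) &
      all (fun i => (iter i (double_mod N) k * d <= l * N)%N
                 || (h * N <= iter i (double_mod N) k * d)%N) (iota 0 n)].

Lemma cycle_avoidsP (R : realType) (n k l h d : nat) :
  (0 < n)%N -> (0 < d)%N -> (k <= (2 ^ n).-1)%N -> cycle_avoids n k l h d ->
  has_cycle_in n (fun p : R => ~~ (l%:R / d%:R < p < h%:R / d%:R)).
Proof.
move=> n0 d0 kN /and3P[/eqP kn /allP kp /allP kQ].
have n1 : (1 < 2 ^ n)%N by rewrite -[1%N](expn0 2) ltn_exp2l.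
have N0 : (0 < (2 ^ n).-1)%N by lia.
have N0' : (0 : R) < ((2 ^ n).-1)%:R by rewrite ltr0n.
have d0' : (0 : R) < d%:R by rewrite ltr0n.
apply: (@has_cycle_inP R n _ (k%:R / ((2 ^ n).-1)%:R)) => //.
- by rewrite divr_ge0 ?ler0n //= ler_pdivrMr // mul1r ler_nat.
- by rewrite iter_doubling_frac // kn.
- move=> i i_n; rewrite iter_doubling_frac //.
  move=> /(congr1 ( *%R ^~ ((2 ^ n).-1)%:R)); rewrite /= !mulfVK ?gt_eqF //.
  move=> /eqP; rewrite eqr_nat; apply/negP/kp; rewrite mem_iota; lia.
- move=> i i_n; rewrite iter_doubling_frac // negb_and -!leNgt.
  rewrite ler_pdivrMr // mulrAC ler_pdivlMr // ler_pdivrMr // mulrAC.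
  by rewrite ler_pdivlMr // -!natrM !ler_nat; apply: kQ; rewrite mem_iota; lia.
Qed.

(** * Reflection in 1/2 *)

(** At 1/2 the two sides would be 1 and 0. *)
Lemma doubling_opp (R : realType) (x : R) :
  x != 1 / 2 -> doubling (1 - x) = 1 - doubling x.
Proof.
rewrite /doubling => x2; case: ifPn; case: ifPn; [|lra|lra|lra].
by move=> h h'; case/eqP: x2; lra.
Qed.

Lemma doubling1 (R : realType) : doubling 1 = 1 :> R.
Proof. by rewrite /doubling; case: ifPn; lra. Qed.

(** The point 1/2 is sent to the fixed point 1, so an orbit through it never returns. *)
Lemma periodic_ne_half (R : realType) (n i : nat) (x : R) :
  (0 < n)%N -> iter n (@doubling R) x = x -> iter i (@doubling R) x != 1 / 2.
Proof.
move=> n0 xn; apply/eqP => xi.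
have it1 j : iter j (@doubling R) 1 = 1 by elim: j => //= j ->; rewrite doubling1.
have itn j : iter (j * n) (@doubling R) x = x.
  by elim: j => //= j IH; rewrite mulSn iterD IH.
have x1 : x = 1.
  have -> : x = iter (i.+1 * n - i.+1) (@doubling R) (iter i.+1 (@doubling R) x).
    by rewrite -iterD subnK ?itn // leq_pmulr.
  rewrite /= xi (_ : doubling _ = 1) ?it1 //.
  by rewrite /doubling; case: ifPn; lra.
by move: xi; rewrite x1 it1; lra.
Qed.

Lemma has_cycle_in_opp (R : realType) (n : nat) (Q : R -> Prop) :
  has_cycle_in n Q -> has_cycle_in n (fun p => Q (1 - p)).
Proof.
move=> [C [x [x01 [n0 xn xk] ->]] CQ].
have opp i : iter i (@doubling R) (1 - x) = 1 - iter i (@doubling R) x.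
  by elim: i => //= i ->; rewrite doubling_opp // (periodic_ne_half _ n0).
apply: (@has_cycle_inP R n _ (1 - x)) => //; first by lra.
- by rewrite opp xn.
- by move=> k kn; rewrite opp => e; apply: (xk k kn); lra.
- by move=> k kn; rewrite opp subKr; apply: CQ; exists k.
Qed.

(** * Cycles given by binary words *)

(* The point whose binary expansion is w followed by that of y. *)
Definition prepend (R : realType) (w : seq bool) (y : R) : R :=
  foldr (fun (d : bool) z => (d%:R + z) / 2) y w.

Fixpoint along (R : realType) (Q : R -> Prop) (w : seq bool) (y : R) : Prop :=
  if w is d :: w' then Q (prepend w y) /\ along Q w' y else True.

Lemma prepend_cat (R : realType) (u v : seq bool) (y : R) :
  prepend (u ++ v) y = prepend u (prepend v y).
Proof. by rewrite /prepend foldr_cat. Qed.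

Lemma prepend01 (R : realType) (w : seq bool) (y : R) :
  0 < y <= 1 -> 0 < prepend w y <= 1.
Proof. by move=> y01; elim: w => //= -[] w; rewrite /=; lra. Qed.

Lemma along_cat (R : realType) (Q : R -> Prop) (u v : seq bool) (y : R) :
  along Q u (prepend v y) -> along Q v y -> along Q (u ++ v) y.
Proof.
elim: u => //= d u IH [Qd Qu] Qv; split; last exact: IH.
by rewrite prepend_cat.
Qed.

Lemma alongP (R : realType) (Q : R -> Prop) (w : seq bool) (y : R) (k : nat) :
  along Q w y -> (k < size w)%N -> Q (prepend (drop k w) y).
Proof. by elim: w k => //= d w IH [|k] [Qd Qw] //= kw; apply: IH. Qed.

(** With y > 0, a leading digit 1 puts the point strictly above 1/2, in the branch of [doubling]
    that strips it. *)
Lemma iter_doubling_prepend (R : realType) (w : seq bool) (y : R) (k : nat) :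
  0 < y <= 1 -> (k <= size w)%N ->
  iter k (@doubling R) (prepend w y) = prepend (drop k w) y.
Proof.
move=> y01; elim: w k => [|d w IH] [|k] //= kw.
rewrite -iterS iterSr -IH //; congr iter.
by have := prepend01 w y01; rewrite /doubling; case: d; case: ifPn => /=; lra.
Qed.

Lemma prepend_affine (R : realType) (w : seq bool) (y : R) :
  prepend w y = prepend w 0 + y / 2 ^+ size w.
Proof.
elim: w => /= [|d w ->]; first by rewrite expr0 divr1 add0r.
by rewrite exprS; field; rewrite expf_neq0.
Qed.

(** Prepending [w] is an affine contraction sending y to c + y / s; a digit 1 makes c, hence the
    fixed point, positive. *)
Lemma prepend_fixpoint (R : realType) (w : seq bool) : true \in w ->
  exists2 x : R, 0 < x <= 1 & prepend w x = x.
Proof.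
move=> w1; set c := prepend w (0 : R); set s := 2 ^+ size w : R.
have s0 : 0 < s by rewrite exprn_gt0.
have c0 : 0 < c.
  rewrite /c; elim: w w1 {c s s0} => //= d w IH; rewrite inE.
  have w0 : 0 <= prepend w (0 : R) by elim: w {IH} => //= -[] w /=; lra.
  by case: d => /= [_|/IH]; lra.
have c1 : c + s^-1 <= 1.
  by have := @prepend_affine R w 1; rewrite mul1r -/c -/s => <-;
    have := @prepend01 R w 1; lra.
have s1 : 0 < 1 - s^-1 by lra.
exists (c / (1 - s^-1)).
  by rewrite divr_gt0 //= ler_pdivrMr // mul1r; lra.
rewrite prepend_affine -/c -/s.
have : 1 - s^-1 != 0 by rewrite gt_eqF.
by move=> h; rewrite -[X in X + _](mulfVK h) -mulrDr subrK mulr1.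
Qed.

(* The cycle of the periodic word d B P ... P (i copies of P), starting at the
   point x; the conditions [p <> x] make its least period the full length.  [I x] is an interval containing x and invariant under
   prepending P, so it contains all the points where a block P ends; affine
   estimates on it then control every point of the cycle. *)
Lemma has_cycle_in_word (R : realType) (d : bool) (B P : seq bool) (i : nat)
    (I : R -> R -> Prop) (Q : R -> Prop) :
  true \in P -> (0 < i)%N ->
  (forall y, 0 < y <= 1 ->
     let x := prepend ((d :: B) ++ P) y in I x x) ->
  (forall x y, I x y ->
     I x (prepend P y) /\ along (fun p => Q p /\ p <> x) P y) ->
  (forall y, let z := prepend P y in let x := prepend (d :: B) z in
     I x y -> Q x /\ along (fun p => Q p /\ p <> x) B z) ->
  has_cycle_in (size (d :: B) + i * size P) Q.
Proof.
move=> P1 i0 HI HP HB; pose Pn j := flatten (nseq j P).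
have PiE : Pn i = P ++ Pn i.-1 by rewrite -{1}(prednK i0).
have sP : (size ((d :: B) ++ Pn i) = size (d :: B) + i * size P)%N.
  by rewrite size_cat size_flatten /shape map_nseq sumn_nseq mulnC.
have [|x x01 xE] := @prepend_fixpoint R ((d :: B) ++ Pn i).
  by rewrite PiE !mem_cat P1 orbT.
have xE' : x = prepend (d :: B) (prepend P (prepend (Pn i.-1) x)).
  by rewrite -!prepend_cat -catA -PiE xE.
(* The digits of the first [P] suffice to locate x: what follows is an arbitrary tail in (0, 1]. *)
have Ix : I x x by rewrite {}xE' -prepend_cat; apply: HI; apply: prepend01.
have IPn j : I x (prepend (Pn j) x) /\ along (fun p => Q p /\ p <> x) (Pn j) x.
  elim: j => [//|j [Ij Aj]]; rewrite /Pn /= -/(Pn j) prepend_cat.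
  by have [? ?] := HP _ _ Ij; split=> //; apply: along_cat.
have [Ii Ai] := IPn i.-1.
have := HB (prepend (Pn i.-1) x); rewrite /= -/(prepend B _) => HBx.
have [Qx AB] : Q x /\ along (fun p => Q p /\ p <> x) (B ++ Pn i) x.
  move: HBx; rewrite -[(_ + _) / 2]/(prepend (d :: B) _) -xE' => /(_ Ii)[Qx AB].
  split=> //; apply: along_cat; first by rewrite PiE prepend_cat.
  exact: (IPn i).2.
have it k : (k < size ((d :: B) ++ Pn i))%N ->
    iter k (@doubling R) x = prepend (drop k ((d :: B) ++ Pn i)) x.
  by move=> kn; rewrite -[in LHS]xE iter_doubling_prepend // ltnW.
rewrite -sP; apply: (@has_cycle_inP R _ _ x) => //; first lra.
- by rewrite -{1}xE iter_doubling_prepend // drop_size.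
- move=> [//|k] /andP[_ kn]; rewrite (it _ kn) /=.
  by apply: (alongP AB _).2.
- move=> [_|k kn]; first exact: Qx.
  by rewrite it //; apply: (alongP AB _).1.
Qed.


(** The interval is closed so that missing it is an open condition, stable under small moves of the
    endpoints. *)
Definition has_cycle_outside (R : realType) (n : nat) (l h : R) : Prop :=
  has_cycle_in n (fun p => ~~ (l <= p <= h)).

Lemma has_cycle_outside_sub (R : realType) (n : nat) (l h a b : R) :
  l <= a -> b <= h -> has_cycle_outside n l h -> has_cycle_outside n a b.
Proof. by move=> la bh; apply: has_cycle_in_sub => p; lra. Qed.

(* [cycle_B_P] uses the word B followed by i copies of P. *)
Lemma cycle_0111_1 (R : realType) (i : nat) : (0 < i)%N ->
  has_cycle_outside (4 + i * 1) (0 : R) (3 / 7).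
Proof.
move=> i0; apply: (@has_cycle_in_word R false [:: true; true; true] [:: true]
  i (fun x y => 7 / 16 < x <= 1 / 2 /\ x <= y <= 1)) => //= *; lra.
Qed.

(** Prepending 100 moves y up towards its fixed point 4/7, so x <= y < 4/7 persists and halves stay
    below 2/7. As x is 1000 prepended to some z > x, it exceeds 8/15, the fixed point of prepending
    1000. *)
Lemma cycle_1000_100 (R : realType) (i : nat) : (0 < i)%N ->
  has_cycle_outside (4 + i * 3) (2 / 7 : R) (8 / 15).
Proof.
move=> i0; apply: (@has_cycle_in_word R true [:: false; false; false]
  [:: true; false; false] i (fun x y => 1 / 2 < x <= y /\ y < 4 / 7)) => //= *;
  lra.
Qed.

Lemma cycle_10000_100 (R : realType) (i : nat) : (0 < i)%N ->
  has_cycle_outside (5 + i * 3) (2 / 7 : R) (16 / 31).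
Proof.
move=> i0; apply: (@has_cycle_in_word R true [:: false; false; false; false]
  [:: true; false; false] i (fun x y => 1 / 2 < x <= y /\ y < 4 / 7)) => //= *;
  lra.
Qed.

Lemma cycle_100000_100 (R : realType) (i : nat) : (0 < i)%N ->
  has_cycle_outside (6 + i * 3) (2 / 7 : R) (32 / 63).
Proof.
move=> i0; apply: (@has_cycle_in_word R true
  [:: false; false; false; false; false]
  [:: true; false; false] i (fun x y => 1 / 2 < x <= y /\ y < 4 / 7)) => //= *;
  lra.
Qed.

(** Here y descends towards 4/7 from above; 40/63 is fixed by prepending 101000, and 20/63 is its
    half. *)
Lemma cycle_101000_100 (R : realType) (i : nat) : (0 < i)%N ->
  has_cycle_outside (6 + i * 3) (20 / 63 : R) (8 / 15).
Proof.
move=> i0; apply: (@has_cycle_in_word R true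
  [:: false; true; false; false; false]
  [:: true; false; false] i (fun x y => 4 / 7 < y <= x /\ x < 40 / 63)) => //= *; lra.
Qed.

Lemma cycle_10100_100 (R : realType) (i : nat) : (0 < i)%N ->
  has_cycle_outside (5 + i * 3) (10 / 31 : R) (8 / 15).
Proof.
move=> i0; apply: (@has_cycle_in_word R true [:: false; true; false; false]
  [:: true; false; false] i (fun x y => 4 / 7 < y <= x /\ x < 20 / 31)) => //= *; lra.
Qed.

Lemma cycle_100_10 (R : realType) (i : nat) : (0 < i)%N ->
  has_cycle_outside (3 + i * 2) (2 / 5 : R) (4 / 7).
Proof.
move=> i0; apply: (@has_cycle_in_word R true [:: false; false]
  [:: true; false] i (fun x y => 1 / 2 < x <= y /\ y < 2 / 3)) => //= *; lra.
Qed.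

(** A second 100 before the copies of 10 changes the parity of the period. *)
Lemma cycle_100100_10 (R : realType) (i : nat) : (0 < i)%N ->
  has_cycle_outside (6 + i * 2) (2 / 5 : R) (4 / 7).
Proof.
move=> i0; apply: (@has_cycle_in_word R true
  [:: false; false; true; false; false]
  [:: true; false] i (fun x y => 1 / 2 < x <= y /\ y < 2 / 3)) => //= *; lra.
Qed.

(** The parity of n selects the word for the last interval, n modulo 3 those for the middle
    three. *)
Lemma long_cycle_cases (R : realType) (n : nat) : (7 <= n)%N ->
  [/\ has_cycle_outside n (0 : R) (3 / 7),
      has_cycle_outside n (2 / 7 : R) (32 / 63),
      has_cycle_outside n (20 / 63 : R) (16 / 31),
      has_cycle_outside n (10 / 31 : R) (8 / 15) &
      has_cycle_outside n (2 / 5 : R) (4 / 7)].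
Proof.
move=> n7.
have c1 := @cycle_0111_1 R (n - 4).
have c5 : has_cycle_outside n (2 / 5 : R) (4 / 7).
  have [on|en] := boolP (odd n).
    have := @cycle_100_10 R (n - 3)./2; rewrite (_ : 3 + _ * 2 = n)%N; last lia.
    by apply; lia.
  have := @cycle_100100_10 R (n - 6)./2; rewrite (_ : 6 + _ * 2 = n)%N; last lia.
  by apply; lia.
rewrite (_ : 4 + _ * 1 = n)%N in c1; last lia.
have [i [i0 [nE|[nE|nE]]]] : exists i, (0 < i)%N /\
    (n = 4 + i * 3 \/ n = 5 + i * 3 \/ n = 6 + i * 3)%N.
  by exists ((n - 4) %/ 3)%N; lia.
(* [2/7, 8/15] contains all three middle intervals. *)
- have c := @cycle_1000_100 R i i0; rewrite -nE in c.
  split=> //; first (by apply: c1; lia); apply: has_cycle_outside_sub c; lra.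
- have c := @cycle_10000_100 R i i0; have c' := @cycle_10100_100 R i i0.
  rewrite -nE in c c'.
  by split=> //; first (by apply: c1; lia); apply: has_cycle_outside_sub c; lra.
- have c := @cycle_100000_100 R i i0; have c' := @cycle_101000_100 R i i0.
  rewrite -nE in c c'.
  by split=> //; first (by apply: c1; lia); apply: has_cycle_outside_sub c'; lra.
Qed.

(** * Reduction to the periods 3, 4, 5, 6 *)

(** A cycle missing (a, b) has a point between the two fractions; being right of a, it cannot be
    left of b. *)
Lemma not_bad_all_cycles_meet (R : realType) (n p q : nat) (a b : R) :
  (3 <= n)%N -> all_cycles_meet n p q -> ~ bad a b n ->
  a < p%:R / ((2 ^ n).-1)%:R -> b <= q%:R / ((2 ^ n).-1)%:R.
Proof.
move=> n3 npq /(not_badE _ _ n3)[C cC CQ] ap.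
have [|x /CQ xab xpq] := all_cycles_meetP _ npq cC; first lia.
by move: ap xpq xab; lra.
Qed.

Lemma not_bad_opp (R : realType) (n : nat) (a b : R) : (3 <= n)%N ->
  ~ bad a b n -> ~ bad (1 - b) (1 - a) n.
Proof.
move=> n3 /(not_badE _ _ n3)/has_cycle_in_opp nab; apply/not_badE => //.
by apply: has_cycle_in_sub nab => p; lra.
Qed.

Lemma long_cycle_outside (R : realType) (n : nat) (a b : R) :
  (7 <= n)%N -> 0 < a -> b < 1 ->
  (forall m : nat, (3 <= m <= 6)%N -> ~ bad a b m) -> has_cycle_outside n a b.
Proof.
move=> n7; wlog ab1 : a b / a + b <= 1 => [IH a0 b1 nb|a0 b1 nb].
  have [|ab1] := lerP (a + b) 1; first by move/IH; apply.
  have : has_cycle_outside n (1 - b) (1 - a).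
    apply: IH; [lra|lra|lra|move=> m m36].
    by apply: not_bad_opp; [lia|apply: nb].
  by move/has_cycle_in_opp; apply: has_cycle_in_sub => p; lra.
have c3 : a < 2 / 7 -> b <= 3 / 7.
  exact: (@not_bad_all_cycles_meet R 3 2 3 a b isT isT (nb 3%N isT)).
have c6 : a < 20 / 63 -> b <= 32 / 63.
  exact: (@not_bad_all_cycles_meet R 6 20 32 a b isT isT (nb 6%N isT)).
have c5 : a < 10 / 31 -> b <= 16 / 31.
  exact: (@not_bad_all_cycles_meet R 5 10 16 a b isT isT (nb 5%N isT)).
have c4 : a < 6 / 15 -> b <= 8 / 15.
  exact: (@not_bad_all_cycles_meet R 4 6 8 a b isT isT (nb 4%N isT)).
have c3' : a < 3 / 7 -> b <= 4 / 7.
  exact: (@not_bad_all_cycles_meet R 3 3 4 a b isT isT (nb 3%N isT)).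
have [i1 i2 i3 i4 i5] := long_cycle_cases R n7.
have [/c3 b3|a1] := ltrP a (2 / 7).
  by apply: has_cycle_outside_sub i1; lra.
have [/c6 b6|a2] := ltrP a (20 / 63).
  by apply: has_cycle_outside_sub i2; lra.
have [/c5 b5|a3] := ltrP a (10 / 31).
  by apply: has_cycle_outside_sub i3; lra.
have [/c4 b4|a4] := ltrP a (6 / 15).
  by apply: has_cycle_outside_sub i4; lra.
(* For a >= 3/7, where [c3'] is silent, a + b <= 1 gives b <= 4/7. *)
by apply: has_cycle_outside_sub i5; lra.
Qed.

(** * Determination of the exit periods *)

Lemma exit_period_le6 (R : realType) (n : nat) :
  exit_period R n -> (3 <= n <= 6)%N.
Proof.
move=> [n3 [t0 [t1 [a [b [[t01 [ca cb] ab01]]]]]]] [_ B0 badn].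
rewrite n3 leqNgt; apply/negP => n7.
have t11 : t0 <= t1 <= t1 by rewrite lexx ltW.
have [a0 _ b1] := ab01 _ t11.
have nb m : ~ bad (a t1) (b t1) m.
  by move=> bm; suff: set0 m by []; rewrite -B0.
have [C cC CQ] : has_cycle_outside n (a t1) (b t1).
  by apply: long_cycle_outside.
have [_ _ al] := (continuous_within_itvP a t01).1 ca.
have [_ _ bl] := (continuous_within_itvP b t01).1 cb.
have [x [_ _ CE]] := cC.
(* The cycle still misses the interval just before [t1], against badness. Indexing by ['I_n] makes
   this a finite conjunction of left-neighbourhood conditions. *)
have : \forall t \near t1^'-, forall k : 'I_n,
    ~~ (a t < iter k (@doubling R) x < b t).
  apply: filter_forall => k.
  have : ~~ (a t1 <= iter k (@doubling R) x <= b t1).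
    by apply: CQ; rewrite CE; exists (k : nat) => /=.
  rewrite negb_and -!ltNge => /orP[xa|bx].
    near=> t; rewrite negb_and -leNgt; apply/orP; left; apply: ltW.
    by near: t; apply: cvgr_gt al _ xa.
  near=> t; rewrite negb_and -!leNgt; apply/orP; right; apply: ltW.
  by near: t; apply: cvgr_lt bl _ bx.
move=> nearC.
suff [t [t0t tC]] : exists t, t0 <= t < t1 /\ forall k : 'I_n,
    ~~ (a t < iter k (@doubling R) x < b t).
  have [_ /(_ _ cC)[p []]] := badn t t0t.
  rewrite CE => -[k /= kn <-] /=; rewrite in_itv /=.
  by apply/negP; apply: (tC (Ordinal kn)).
near t1^'- => t; exists t; split; last by near: t.
apply/andP; split; near: t; [exact: nbhs_left_ge | exact: nbhs_left_lt].
Unshelve. all: by end_near. Qed.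

(* [ks] lists numerators, over 2 ^ m - 1 for m = 3, ..., 6, of points of m-cycles that
   miss the open interval with endpoints p / (2 ^ n - 1) and q / (2 ^ n - 1). *)
Definition exit_witness (n p q : nat) (ks : seq nat) : bool :=
  let N := (2 ^ n).-1 in
  [&& (3 <= n <= 6)%N, (N < 10 * p)%N, (p < q)%N, (10 * q < 9 * N)%N,
      all_cycles_meet n p q &
      all (fun m => let k := nth 0%N ks (m - 3) in
             (k <= (2 ^ m).-1)%N && cycle_avoids m k p q N)
          (iota 3 4)].

Lemma exit_witnessP (R : realType) (n p q : nat) (ks : seq nat) :
  exit_witness n p q ks -> exit_period R n.
Proof.
move=> /and5P[/andP[n3 n6] pN pq qN /andP[npq /allP avoid]].
have n1 : (1 < 2 ^ n)%N by rewrite -[1%N](expn0 2) ltn_exp2l //; lia.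
have N0 : (0 : R) < ((2 ^ n).-1)%:R by rewrite ltr0n; lia.
have N0' : (0 < (2 ^ n).-1)%N by lia.
pose P : R := p%:R / ((2 ^ n).-1)%:R; pose Q : R := q%:R / ((2 ^ n).-1)%:R.
have P1 : 1 / 10 < P.
  rewrite /P ltr_pdivlMr // mulrAC mul1r ltr_pdivrMr // -natrM ltr_nat; lia.
have PQ : P < Q by rewrite /P /Q ltr_pM2r ?invr_gt0 // ltr_nat.
have Q1 : Q < 9 / 10.
  rewrite /Q ltr_pdivrMr // mulrAC ltr_pdivlMr // -!natrM ltr_nat; lia.
have nb m : (3 <= m <= 6)%N -> ~ bad P Q m.
  move=> m36; have /avoid/andP[km avm] : m \in iota 3 4 by rewrite mem_iota; lia.
  by apply/not_badE; [lia|apply: cycle_avoidsP avm => //; lia].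
(* The margins shrink linearly from 1/10 to 0: [P1] and [Q1] keep the family inside (0, 1), and for
   t < 1 the open interval contains [P, Q]. *)
split=> //; exists 0, 1, (fun t => P - (1 - t) / 10), (fun t => Q + (1 - t) / 10).
split; split=> //.
- have lin : continuous (fun t : R => (1 - t) / 10).
    move=> t; apply: cvgM; last exact: cvg_cst.
    by apply: cvgB; [exact: cvg_cst|exact: cvg_id].
  split; apply: continuous_subspaceT => t.
    by apply: cvgB; [exact: cvg_cst|exact: lin].
  by apply: cvgD; [exact: cvg_cst|exact: lin].
- by move=> t t01; split; lra.
- move=> t t' t01 t'01 tt'; split.
    by move=> x /=; rewrite !in_itv /=; lra.
  (* The left endpoint of the smaller interval shows that the inclusion is strict. *)
  move=> /(_ (P - (1 - t) / 10)) /=; rewrite !in_itv /=; lra.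
- rewrite subrr mul0r subr0 addr0; apply/seteqP; split=> // m bm.
  have m3 : (3 <= m)%N by case: bm.
  have [m6|m7] := leqP m 6; first by apply: (nb m) => //; rewrite m3.
  apply/not_badE: bm => //; apply: has_cycle_in_sub (long_cycle_outside m7 _ _ nb).
  + by move=> x; lra.
  + lra.
  + lra.
- move=> t t01; split=> // C cC.
  have [|x Cx xPQ] := @all_cycles_meetP R n p q C _ npq cC; first lia.
  exists x; split=> //=; rewrite in_itv /=; move: xPQ; rewrite -/P -/Q; lra.
Qed.

Theorem proposition2p6 (R : realType) :
  EP R = [set 3; 4; 5; 6]%N.
Proof.
apply/seteqP; split=> [n /exit_period_le6|n /= n36].
  by case: n => [|[|[|[|[|[|[|n]]]]]]] //= _;
    [left; left; left|left; left; right|left; right|right].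
case: n36 => [[[]|]|] ->.
(* The cycles of the words 001, 0011, 00101, 001011. *)
- exact: (@exit_witnessP R 3 3 4 [:: 1; 3; 5; 11]%N).
- exact: (@exit_witnessP R 4 6 8 [:: 1; 3; 5; 11]%N).
- exact: (@exit_witnessP R 5 10 16 [:: 1; 1; 1; 5]%N).
(* The cycle of 1 / (2^m - 1) has no point strictly between 2/7 and 32/63. *)
- exact: (@exit_witnessP R 6 20 32 [:: 1; 1; 1; 1]%N).
Qed.
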